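(* There exists a constant $c$ such that for each $n\in\mathbb N$ and each $n$-ary Boolean function $f:\mathbb B^n\to\mathbb B$, there exists an instruction sequence $X\in\mathcal{IS}^{0}_{br}$ in which no jump instruction other than $\#2$ occurs, such that $X$ computes $f$ and $|X|\le c\cdot 2^n$ (i.e. $|X|=O(2^n)$).
   Context: Let $\mathbb B=\{\mathsf T,\mathsf F\}$. There are Boolean registers named $\mathtt{in}{:}i$ ($i\ge1$, input registers), $\mathtt{aux}{:}i$ ($i\ge1$, auxiliary registers) and $\mathtt{out}$ (output register). A Boolean register can process the methods $\mathtt{set{:}T}$ (content becomes $\mathsf T$, reply $\mathsf T$), $\mathtt{set{:}F}$ (content becomes $\mathsf F$, reply $\mathsf F$) and $\mathtt{get}$ (nothing changes, reply is the content). A basic instruction has the form $f.m$ with $f$ a register name and $m$ a method. Primitive instructions are: for each basic instruction $a$, the plain basic instruction $a$, the positive test instruction $+a$ and the negative test instruction $-a$; for each $l\in\mathbb N$ the forward jump instruction $\#l$; and the termination instruction $!$. An instruction sequence is a finite non-empty sequence $X=u_1;\dots;u_k$ of primitive instructions; its length is $|X|=k$. Execution starts at $u_1$: for $a$, $a$ is executed and execution proceeds with the next instruction; for $+a$, $a$ is executed and execution proceeds with the next instruction if the reply is $\mathsf T$, otherwise the next instruction is skipped and execution proceeds with the one after it; $-a$ is the same with the role of the reply reversed; for $\#l$ execution proceeds with the $l$-th next instruction ($\#0$ causes inaction); $!$ terminates execution; if there is no instruction to proceed with, inaction occurs. $\mathcal{IS}_{br}$ is the set of instruction sequences in which every basic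 instruction is of the form $\mathtt{in}{:}i.\mathtt{get}$, $\mathtt{aux}{:}i.\mathtt{get}$, $\mathtt{aux}{:}i.\mathtt{set{:}}b$ or $\mathtt{out}.\mathtt{set{:}}b$ ($i\ge1$, $b\in\mathbb B$). For $k,l\in\mathbb N$, $\mathcal{IS}^{k,l}_{br}$ is the set of $X\in\mathcal{IS}_{br}$ in which no instruction involving a register $\mathtt{aux}{:}i$ with $i>k$ and no jump $\#l'$ with $l'>l$ occurs; $\mathcal{IS}^{k}_{br}=\bigcup_{l\in\mathbb N}\mathcal{IS}^{k,l}_{br}$ (so $\mathcal{IS}^0_{br}$ uses no auxiliary registers). For $f:\mathbb B^n\to\mathbb B$, $X\in\mathcal{IS}_{br}$ computes $f$ if for all $b_1,\dots,b_n\in\mathbb B$: when $X$ is executed with $\mathtt{in}{:}i$ initially containing $b_i$ ($1\le i\le n$) and all auxiliary registers and $\mathtt{out}$ initially containing $\mathsf F$, execution never executes an instruction on an input register $\mathtt{in}{:}i$ with $i>n$, ends by executing $!$ (not by inaction), and the final content of $\mathtt{out}$ is $f(b_1,\dots,b_n)$. *)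

(* Defs.v *)
(* Mathematical Components. *)
From HB Require Import structures.
From mathcomp Require Import all_boot.
Set Implicit Arguments.
Unset Strict Implicit.
Unset Printing Implicit Defensive.

(* Registers are numbered from 1: the names [In 0] and [Aux 0] are excluded by
   [basic_br] and [available] below. *)
Inductive reg := In of nat | Aux of nat | Out.

Definition reg_code (r : reg) : nat + nat + unit :=
  match r with In i => inl (inl i) | Aux i => inl (inr i) | Out => inr tt end.
Definition reg_decode (c : nat + nat + unit) : reg :=
  match c with inl (inl i) => In i | inl (inr i) => Aux i | inr _ => Out end.
Lemma reg_codeK : cancel reg_code reg_decode. Proof. by case. Qed.
HB.instance Definition _ := Equality.copy reg (can_type reg_codeK).

Inductive meth := Set_ of bool | Get.

Definition reply (m : meth) (content : bool) : bool :=
  if m is Set_ b then b else content.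
Definition new_content (m : meth) (content : bool) : bool :=
  if m is Set_ b then b else content.

Record basic := Basic { focus : reg; method : meth }.

Inductive instr :=
| Plain of basic
| PosTest of basic
| NegTest of basic
| Jump of nat
| Halt.

Definition basic_of (u : instr) : option basic :=
  match u with Plain a | PosTest a | NegTest a => Some a | _ => None end.

Definition basic_br (a : basic) : bool :=
  match focus a, method a with
  | In i, Get => 0 < i
  | Aux i, _ => 0 < i
  | Out, Set_ _ => true
  | _, _ => false
  end.

Definition IS_br (X : seq instr) : bool :=
  (0 < size X) && all (fun u => oapp basic_br true (basic_of u)) X.

Definition aux_at_most (k : nat) (u : instr) : bool :=
  oapp (fun a => if focus a is Aux i then i <= k else true) true (basic_of u).

Definition jump_at_most (l : nat) (u : instr) : bool :=
  if u is Jump l' then l' <= l else true.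

Definition IS_br_kl (k l : nat) (X : seq instr) : bool :=
  [&& IS_br X, all (aux_at_most k) X & all (jump_at_most l) X].

Definition IS_br_k (k : nat) (X : seq instr) : Prop :=
  exists l : nat, IS_br_kl k l X.

Definition only_jumps_of (l : nat) (X : seq instr) : bool :=
  all (fun u => if u is Jump l' then l' == l else true) X.

Definition state := reg -> bool.

Definition update (a : basic) (s : state) : state :=
  fun r => if r == focus a then new_content (method a) (s r) else s r.

Definition basic_reply (a : basic) (s : state) : bool :=
  reply (method a) (s (focus a)).

(* [exec D X p s s']: execution of [X] from the instruction at position [p]
   (counted from 0) in state [s] executes only basic instructions on registers
   satisfying [D], and ends by executing the termination instruction, in state
   [s'].  Execution is deterministic.  Inaction is the absence of a derivation:
   no rule applies when [p] is past the end of [X], and [Jump 0] leads back to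
   the same configuration, so that no finite derivation starts there. *)
Inductive exec (D : pred reg) (X : seq instr) :
  nat -> state -> state -> Prop :=
| exec_plain p s s' a :
    onth X p = Some (Plain a) -> D (focus a) ->
    exec D X p.+1 (update a s) s' -> exec D X p s s'
| exec_pos p s s' a :
    onth X p = Some (PosTest a) -> D (focus a) ->
    exec D X (if basic_reply a s then p.+1 else p.+2) (update a s) s' ->
    exec D X p s s'
| exec_neg p s s' a :
    onth X p = Some (NegTest a) -> D (focus a) ->
    exec D X (if basic_reply a s then p.+2 else p.+1) (update a s) s' ->
    exec D X p s s'
| exec_jump p s s' l :
    onth X p = Some (Jump l) ->
    exec D X (p + l) s s' -> exec D X p s s'
| exec_halt p s :
    onth X p = Some Halt -> exec D X p s s.

Definition available (n : nat) : pred reg :=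
  fun r => match r with In i => 0 < i <= n | Aux i => 0 < i | Out => true end.

(* [In i] holds the [i]-th bit; the content given to input registers outside
   1..n is immaterial, since they are not [available]. *)
Definition init_state (n : nat) (b : n.-tuple bool) : state :=
  fun r => if r is In i then nth false b i.-1 else false.

Definition computes (n : nat) (X : seq instr) (f : n.-tuple bool -> bool) :
  Prop :=
  forall b : n.-tuple bool, exists s' : state,
    exec (available n) X 0 (init_state b) s' /\ s' Out = f b.

(* Main.v *)
(** Tests chained with #2 carry a single bit of control: whether all literals
    tested so far hold.  So "if the inputs match a pattern of length [k] then
    perform one action" costs [2k+1] instructions, and writing out all minterms
    of [f] would cost about [n * 2^n].  To save the factor [n], split the inputs
    into [j] low bits, with [2^j] of order [n], and [n - j] high bits.  For each
    of the [2^2^j] functions [g] of the low bits, overwrite [out] by [g(low)],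
    whatever the high bits are; then, for each high pattern [y] with
    [f(-, y) = g], halt if the high bits are [y].  There are [2^(n-j)]
    halting tests of cost [O(n)], in total [O(2^n)], and as [4 * 2^j <= n] the
    tables of all the functions [g] also cost only [O(2^n)]. *)
Require Import Defs.
From mathcomp Require Import all_boot.
From mathcomp Require Import zify.
Set Implicit Arguments.
Unset Strict Implicit.

Definition test (i : nat) (c : bool) : instr :=
  (if c then NegTest else PosTest) (Basic (In i.+1) Get).

(* Control enters at position 0 when all literals tested so far hold, and at
   position 1 otherwise; a literal that holds skips the jump after its test. *)
Fixpoint cond (o : nat) (s : seq bool) (act : instr) : seq instr :=
  if s is c :: s' then [:: test o c, Jump 2 & cond o.+1 s' act] else [:: act].

Definition write (c : bool) : instr := Plain (Basic Out (Set_ c)).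

Definition table j (g : j.-tuple bool -> bool) (l : seq (j.-tuple bool)) :=
  flatten [seq cond 0 z (write (g z)) | z : j.-tuple bool <- l].

Definition lock j k (l : seq (k.-tuple bool)) :=
  flatten [seq cond j y Halt | y : k.-tuple bool <- l].

Definition section j k (F : seq bool -> bool) (y : k.-tuple bool) :
  {ffun j.-tuple bool -> bool} := [ffun z : j.-tuple bool => F (z ++ y)].

Definition stage j k F (g : {ffun j.-tuple bool -> bool}) : seq instr :=
  table g (enum {: j.-tuple bool}) ++
  lock j (enum [pred y : k.-tuple bool | section j F y == g]).

Definition program j k F : seq instr :=
  flatten [seq stage k F g | g <- enum {: {ffun j.-tuple bool -> bool}}]
  ++ [:: Halt].

Lemma exec_cons D u X p s s' : exec D X p s s' -> exec D (u :: X) p.+1 s s'.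
Proof.
elim=> {p s s'} [p s s' a Xp Da _|p s s' a Xp Da _|p s s' a Xp Da _|p s s' l Xp _|p s Xp].
- exact: exec_plain.
- by move=> IH; apply: (@exec_pos D (u :: X) p.+1 s s' a Xp Da); case: ifP IH.
- by move=> IH; apply: (@exec_neg D (u :: X) p.+1 s s' a Xp Da); case: ifP IH.
- exact: (@exec_jump D (u :: X) p.+1).
- exact: exec_halt.
Qed.

Section Run.

Variable b : seq bool.

Definition holds (o : bool) (s : state) : Prop :=
  (forall i, s (In i.+1) = nth false b i) /\ s Out = o.

(** Continuation style: [X] is all that remains to be executed and [o] the content of [Out] on
    entry. As jumps are relative and forward, blocks can be verified by prepending them to what
    follows. *)
Definition run (X : seq instr) (o v : bool) : Prop :=
  forall s, holds o s ->
    exists s', exec (available (size b)) X 0 s s' /\ s' Out = v.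

Lemma run_halt X o : run (Halt :: X) o o.
Proof. by move=> s [_ so]; exists s; split=> //; apply: exec_halt. Qed.

Lemma run_write c X o v : run X c v -> run (write c :: X) o v.
Proof.
move=> HX s [sI _].
have [|s' [Es' ?]] := HX (update (Basic Out (Set_ c)) s); first by split.
exists s'; split=> //.
exact: (exec_plain (a := Basic Out (Set_ c)) _ _ (exec_cons _ Es')).
Qed.

Lemma run_jump2 u X o v : run X o v -> run [:: Jump 2, u & X] o v.
Proof.
move=> HX s /HX[s' [Es' ?]]; exists s'; split=> //.
by apply: (@exec_jump _ _ _ _ _ 2) => //; do 2 apply: exec_cons.
Qed.

Lemma run_test i c u X o v : i < size b ->
  run (if nth false b i == c then X else u :: X) o v ->
  run [:: test i c, u & X] o v.
Proof.
move=> ib HX s [sI so]; set a := Basic (In i.+1) Get.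
have [|s' [Es' ?]] := HX (update a s).
  by split=> [k|] //; rewrite /update; case: ifP => _; rewrite /= sI.
exists s'; split=> //; rewrite /test.
have aE : basic_reply a s = nth false b i by rewrite /basic_reply /= sI.
by case: c HX Es' => _ Es'; [apply: (exec_neg (a := a)) | apply: (exec_pos (a := a))];
  rewrite //= aE; case: (nth false b i) Es' => /= Es'; do !apply: exec_cons.
Qed.

(** [behead] stands for entry at position 1: each #2 passes over the next test and lands on the jump
    behind it, and the last one passes over [act]. *)
Lemma run_cond_inactive i p act X o v :
  run X o v -> run (behead (cond i p act ++ X)) o v.
Proof.
move=> HX; elim: p i => [|c p IH] i //=.
by case: p IH => [|d p] IH /=; apply: run_jump2 => //; apply: (IH i.+1).
Qed.

Lemma run_cond i p act X o v : i + size p <= size b ->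
  run (if prefix p (drop i b) then act :: X else X) o v ->
  run (cond i p act ++ X) o v.
Proof.
elim: p i => [|c p IH] i //= ib; first by rewrite prefix0s.
rewrite (drop_nth false) ?prefix_cons; last by lia.
move=> HX; apply: run_test; first by lia.
rewrite eq_sym; case: eqP HX => [_|_] HX; first by apply: IH; rewrite ?addSnnS.
exact: (@run_cond_inactive i (c :: p)).
Qed.

(** Only [z] among the patterns of length [j] is a prefix of [b], so no value other than [g z] is
    ever written. *)
Lemma run_table j (g : j.-tuple bool -> bool) (z : j.-tuple bool) l X o v :
  prefix z b ->
  run X (if z \in l then g z else o) v -> run (table g l ++ X) o v.
Proof.
move=> zb; have jb : j <= size b by rewrite -(size_tuple z) size_prefix.
elim: l o => [|y l IH] o //= HX.
rewrite /table /= -catA; apply: run_cond; first by rewrite size_tuple.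
have -> : prefix y (drop 0 b) = (z == y).
  by rewrite drop0 prefixE size_tuple; move: zb; rewrite prefixE size_tuple => /eqP->.
rewrite in_cons in HX.
case: eqP HX => [<-|_] HX; last exact: IH.
by apply: run_write; apply: IH; case: ifP HX.
Qed.

Lemma run_lock j k (l : seq (k.-tuple bool)) (y : k.-tuple bool) X o v :
  drop j b = y -> j + k = size b ->
  (if y \in l then v = o else run X o v) -> run (lock j l ++ X) o v.
Proof.
move=> by_ jk; elim: l => [|x l IH] //= HX.
rewrite /lock /= -catA; apply: run_cond; first by rewrite size_tuple jk.
rewrite by_ prefixE size_tuple take_oversize ?size_tuple //.
rewrite in_cons -val_eqE /= in HX.
by case: eqP HX => [_ ->|_ /IH] //; apply: run_halt.
Qed.

Lemma run_program j k F o : j + k = size b -> run (program j k F) o (F b).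
Proof.
move=> jk.
have zP : size (take j b) == j by rewrite size_take; case: ltngtP; lia.
have yP : size (drop j b) == k by rewrite size_drop; lia.
pose z := Tuple zP; pose y := Tuple yP.
rewrite /program.
have: section j F y \in enum {: {ffun j.-tuple bool -> bool}} by rewrite mem_enum.
(* [o] is generalized because the stage of a wrong [g] leaves an arbitrary value in [Out], which the
   next table overwrites. *)
elim: (enum _) o => [|g l IH] o //=; rewrite in_cons -!catA => gl.
apply: (@run_table j g z); first exact: prefix_take.
rewrite mem_enum; apply: (@run_lock _ _ _ y) => //.
rewrite mem_enum inE; case: eqP gl => [<- _|_]; last exact: IH.
by rewrite ffunE /= cat_take_drop.
Qed.

End Run.

Definition admissible (u : instr) : bool :=
  [&& oapp basic_br true (basic_of u), aux_at_most 0 u &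
      if u is Jump l then l == 2 else true].

Lemma all_cond i p act : admissible act -> all admissible (cond i p act).
Proof. by move=> Hact; elim: p i => [|[] p IH] i /=; rewrite ?Hact ?IH. Qed.

Lemma all_flatten_map (T : Type) (U : Type) (P : pred U) (h : T -> seq U) l :
  (forall x, all P (h x)) -> all P (flatten [seq h x | x <- l]).
Proof. by move=> Ph; elim: l => //= x l IH; rewrite all_cat Ph. Qed.

Lemma all_program j k F : all admissible (program j k F).
Proof.
rewrite all_cat /= andbT; apply: all_flatten_map => g.
by rewrite all_cat; apply/andP; split; apply: all_flatten_map => x; apply: all_cond.
Qed.

Lemma size_cond i p act : size (cond i p act) = (size p).*2.+1.
Proof. by elim: p i => //= c p IH i; rewrite IH. Qed.

Lemma size_flatten_map (T U : Type) (h : T -> seq U) l :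
  size (flatten [seq h x | x <- l]) = \sum_(x <- l) size (h x).
Proof. by elim: l => [|x l IH]; rewrite ?big_nil // big_cons /= size_cat IH. Qed.

Lemma size_program j k F :
  size (program j k F) =
  (2 ^ 2 ^ j * (2 ^ j * j.*2.+1) + 2 ^ k * k.*2.+1).+1.
Proof.
rewrite size_cat addn1 size_flatten_map big_enum; congr _.+1.
under eq_bigr => g _.
  rewrite size_cat !size_flatten_map.
  under eq_bigr do rewrite size_cond size_tuple.
  under [X in _ + X]eq_bigr do rewrite size_cond size_tuple.
  rewrite !big_enum sum_nat_const card_tuple card_bool.
  over.
rewrite big_split /= sum_nat_const card_ffun card_tuple card_bool; congr (_ + _).
(* Each high pattern has exactly one section, hence is tested in exactly one stage. *)
transitivity (\sum_(y : k.-tuple bool) k.*2.+1).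
  by rewrite [RHS](partition_big (@section j k F) predT).
by rewrite sum_nat_const card_tuple card_bool.
Qed.

Lemma split_size n : exists j k, j + k = n /\
  (2 ^ 2 ^ j * (2 ^ j * j.*2.+1) + 2 ^ k * k.*2.+1).+1 <= 33 * 2 ^ n.
Proof.
(* For [n >= 4] this gives [4 * 2 ^ j <= n < 8 * 2 ^ j]. For smaller [n] the subtraction truncates
   to [j = 0], whence the weaker bound [3 * 2 ^ j <= n + 3]. *)
pose j := trunc_log 2 n - 2.
have [jn n_lt] : 3 * 2 ^ j <= n + 3 /\ n < 2 ^ j * 8.
  rewrite /j => {j}; have [n4|n4] := ltnP n 4.
    by case: n n4 => [|[|[|[|]]]].
  have /andP[] := trunc_log_bounds (isT : 1 < 2) (ltac:(lia) : 0 < n).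
  have : 2 <= trunc_log 2 n by rewrite trunc_log_max.
  move: (trunc_log 2 n) => [|[|t]] // _.
  by rewrite !subSS subn0 !expnS; lia.
have j_lt : j < 2 ^ j by apply: ltn_expl.
exists j, (n - j); split; first by lia.
have tables : 2 ^ 2 ^ j * (2 ^ j * j.*2.+1) <= 16 * 2 ^ n.
  have m_lt : 2 ^ j < 2 ^ 2 ^ j by apply: ltn_expl.
  (* All three factors are bounded through [N = 2 ^ 2 ^ j]; the resulting [2 * N ^ 3] is where
     [3 * 2 ^ j] comes from. *)
  apply: (@leq_trans (2 ^ 2 ^ j * (2 ^ 2 ^ j * (2 * 2 ^ 2 ^ j)))).
    by rewrite leq_mul2l leq_mul ?orbT //; lia.
  have -> : 2 ^ 2 ^ j * (2 ^ 2 ^ j * (2 * 2 ^ 2 ^ j)) = 2 * 2 ^ (3 * 2 ^ j).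
    by rewrite [3 * _]mulnC expnM !expnS expn0; nia.
  have : 2 ^ (3 * 2 ^ j) <= 2 ^ (n + 3) by rewrite leq_exp2l.
  by rewrite expnD; lia.
have locks : 2 ^ (n - j) * (n - j).*2.+1 <= 16 * 2 ^ n.
  apply: (@leq_trans (2 ^ (n - j) * (2 ^ j * 16))).
    by rewrite leq_mul2l; lia.
  by rewrite mulnA -expnD subnK; lia.
(* 33 = 16 + 16 + 1, the last unit absorbing the final [Halt]. *)
have : 0 < 2 ^ n by rewrite expn_gt0.
lia.
Qed.

Theorem theorem1 :
  exists c : nat, forall (n : nat) (f : n.-tuple bool -> bool),
    exists X : seq instr,
      [/\ IS_br_k 0 X, only_jumps_of 2 X, computes X f & size X <= c * 2 ^ n].
Proof.
exists 33 => n f; have [j [k [jk le_size]]] := split_size n.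
(* Extending [f] to all sequences avoids casts along [j + k = n]; the default is never met at length
   [n]. *)
pose F (s : seq bool) : bool := oapp f false (insub s).
exists (program j k F); have X_ok := all_program j k F; split.
- exists 2; apply/and3P; split.
  + apply/andP; split; first by rewrite size_program.
    by apply: sub_all X_ok => u /and3P[].
  + by apply: sub_all X_ok => u /and3P[].
  + by apply: sub_all X_ok => u /and3P[_ _]; case: u => //= l /eqP->.
- by apply: sub_all X_ok => u /and3P[].
- move=> b; have := @run_program b j k F false.
  by rewrite /run size_tuple {2}/F valK; apply.
- by rewrite size_program.
Qed.
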